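(* Let $U$ be a quantum walk on a graph with tails $\Gamma=(V,A)$ satisfying Assumptions 1 and 2 (stated in the context), and let $E=\chi_{\mathsf{int}}U\chi_{\mathsf{int}}^*$. For $\lambda\in\mathbf C/2\pi\mathbf Z$ with $\mathrm{Im}\,\lambda<0$, $e^{-i\lambda}$ is a resonance of $U$ if and only if $e^{-i\lambda}$ is an eigenvalue of the finite matrix $E$.
   Context: **Graph with tails.** $\Gamma=(V,A)$ is a connected infinite graph with vertex set $V$ and set $A$ of oriented edges $a=(o(a),t(a))$, with $\overline a=(t(a),o(a))\in A$ whenever $a\in A$. $V=V_{\mathsf{int}}\cup V_{\mathsf t,1}\cup\dots\cup V_{\mathsf t,N}$ and $A=A_{\mathsf{int}}\sqcup A_{\mathsf t,1}\sqcup\dots\sqcup A_{\mathsf t,N}$, $N\ge1$, where $\Gamma_{\mathsf{int}}=(V_{\mathsf{int}},A_{\mathsf{int}})$ is finite and connected, $V_{\mathsf t,j}=\{v_{j,k};k\ge 0\}$ with $v_{j,0}\in V_{\mathsf{int}}$, and $A_{\mathsf t,j}=\{a^\flat_{j,k}=(v_{j,k+1},v_{j,k});k\ge0\}\cup\{a^\sharp_{j,l}=(v_{j,l-1},v_{j,l});l\ge1\}$. Each tail is a half-line attached to $\Gamma_{\mathsf{int}}$ only at $v_{j,0}$; several tails may share the same vertex $v_{j,0}$. $A_v^\flat=\{a\in A;t(a)=v\}$, $\deg(v)=\#A_v^\flat$. **Quantum walk.** $\mathcal H=\ell^2(A)$, $S\psi(a)=\psi(\overline a)$, $C\psi(a)=\sum_{b\in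 A^\flat_{t(a)}}c^{t(a)}_{a,b}\psi(b)$ with $c^v=[c^v_{a,b}]_{a,b\in A_v^\flat}$ a unitary $\deg(v)\times\deg(v)$ matrix for each $v\in V$, and $U=SC$ (acting on $\mathbf C^A$ and on $\mathcal H$). **Assumption 1.** $U\psi(a_{j,k}^\flat)=\psi(a^\flat_{j,k+1})$ and $U\psi(a^\sharp_{j,l+1})=\psi(a^\sharp_{j,l})$ for $k\ge0$, $l\ge1$, $j=1,\dots,N$ (i.e. $c^{v_{j,k}}=\begin{bmatrix}0&1\\1&0\end{bmatrix}$ for $k\ge1$). **Assumption 2.** $U$ and a reference operator $U_0$ are unitary on $\mathcal H$, both satisfy Assumption 1, and $U_0=\widetilde U_0\oplus U_{\mathsf{int}}$ on $\big(\bigoplus_j\ell^2(A_{\mathsf t,j})\big)\oplus\mathbf C^{A_{\mathsf{int}}}$ with $\widetilde U_0\psi(a^\sharp_{j,1})=\psi(a^\flat_{j,0})$ and $U_{\mathsf{int}}$ unitary on $\mathbf C^{A_{\mathsf{int}}}$; $U-U_0$ has finite rank. **Compression.** $\chi_{\mathsf{int}}:\mathbf C^A\to\mathbf C^{A_{\mathsf{int}}}$ is restriction to $A_{\mathsf{int}}$, and $\chi_{\mathsf{int}}^*:\mathbf C^{A_{\mathsf{int}}}\to\mathbf C^A$ is extension by zero. **Complex distortion and resonances.** For $\theta\in\mathbf C/2\pi\mathbf Z$ let $Q(\theta)$ act on $\mathbf C^A$ as multiplication by $q_\theta$, where $q_\theta(a^\flat_{j,k})=e^{i\theta k}$ ($k\ge0$),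 $q_\theta(a^\sharp_{j,l})=e^{-i\theta l}$ ($l\ge1$), $q_\theta=1$ on $A_{\mathsf{int}}$. $U(\theta)=Q(\theta)UQ(\theta)^{-1}$; for real $\theta$ this is unitary on $\mathcal H$ and it extends (analytically in $\theta$) to a bounded operator on $\mathcal H$ for $\mathrm{Im}\,\theta<0$. For $\mathrm{Im}\,\lambda>\mathrm{Im}\,\theta$, $\mathrm{Im}\,\theta<0$, $e^{-i\lambda}$ is called a *resonance* of $U$ if $e^{-i\lambda}$ is an eigenvalue of $U(\theta)$ on $\mathcal H$; this does not depend on the choice of $\theta$ with $\mathrm{Im}\,\theta<\min(0,\mathrm{Im}\,\lambda)$. *)

(* Defs.v *)
From HB Require Import structures.
From mathcomp Require Import all_boot all_order all_algebra.
From mathcomp Require Import finmap complex.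
From mathcomp Require Import all_classical all_reals all_analysis.

Set Implicit Arguments.
Unset Strict Implicit.
Unset Printing Implicit Defensive.

Import Order.TTheory GRing.Theory Num.Theory.
Local Open Scope classical_set_scope.
Local Open Scope ring_scope.

(* The disjointness of int_arcs and of the N tail arc sets is not a field: it
   follows from int_arc_ends, tail_notin_int and tail_inj (the lemmas
   flat_tail, sharp_tail, flat_inj, sharp_inj and flat_neq_sharp below).  The
   arc set is a symmetric subset of V * V; loops inside int_arcs are allowed. *)
Record graph_with_tails (N : nat) := GraphWithTails {
  vertex : choiceType;
  is_arc : pred (vertex * vertex);
  int_vertices : {fset vertex};
  int_arcs : {fset vertex * vertex};
  tail : 'I_N -> nat -> vertex;
  tails_gt0 : (0 < N)%N;
  arc_sym : forall u v, is_arc (u, v) -> is_arc (v, u);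
  vertex_infinite : infinite_set [set: vertex];
  graph_connected : forall u v,
    exists2 p, path (fun x y => is_arc (x, y)) u p & last u p = v;
  vertex_cover : forall v, v \in int_vertices \/ exists j k, v = tail j k;
  arc_cover : forall a, is_arc a <->
    [\/ a \in int_arcs,
        exists j k, a = (tail j k.+1, tail j k)
      | exists j k, a = (tail j k, tail j k.+1)];
  int_arc_ends : forall a, a \in int_arcs ->
    a.1 \in int_vertices /\ a.2 \in int_vertices;
  int_connected : forall u v, u \in int_vertices -> v \in int_vertices ->
    exists2 p, path (fun x y => (x, y) \in int_arcs) u p & last u p = v;
  tail0_int : forall j, tail j 0%N \in int_vertices;
  tail_notin_int : forall j k, tail j k.+1 \notin int_vertices;
  tail_inj : forall i j k l, tail i k.+1 = tail j l.+1 -> i = j /\ k = l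
}.

Section Arcs.
Context {N : nat} (G : graph_with_tails N).

Definition oarc := {a : vertex G * vertex G | is_arc a}.

Definition source (a : oarc) : vertex G := (val a).1.
Definition target (a : oarc) : vertex G := (val a).2.

Lemma rev_arc_subproof (a : oarc) : is_arc (target a, source a).
Proof. by apply: arc_sym; rewrite /source /target -surjective_pairing; apply: valP. Qed.

Definition rev_arc (a : oarc) : oarc := Sub (target a, source a) (rev_arc_subproof a).

Definition in_arcs (v : vertex G) : set oarc := [set a | target a = v].

Lemma flat_subproof j k : is_arc (tail G j k.+1, tail G j k).
Proof. by apply/arc_cover; constructor 2; exists j, k. Qed.

Lemma sharp_subproof j k : is_arc (tail G j k, tail G j k.+1).
Proof. by apply/arc_cover; constructor 3; exists j, k. Qed.

Definition flat (j : 'I_N) (k : nat) : oarc :=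
  Sub (tail G j k.+1, tail G j k) (flat_subproof j k).

(* The outgoing arcs a^sharp_{j,l} are numbered from l = 1 in the mathematics
   and from 0 here: sharp j l is a^sharp_{j,l+1}. *)
Definition sharp (j : 'I_N) (l : nat) : oarc :=
  Sub (tail G j l, tail G j l.+1) (sharp_subproof j l).

Definition int_arc := (int_arcs G : finType).

Lemma arc_of_int_subproof (a : int_arc) : is_arc (fsval a).
Proof. by apply/arc_cover; constructor 1; apply: fsvalP. Qed.

Definition arc_of_int (a : int_arc) : oarc :=
  Sub (fsval a) (arc_of_int_subproof a).

Definition tail_arc := {a : oarc | val a \notin int_arcs G}.

Lemma flat_tail j k : val (flat j k) \notin int_arcs G.
Proof.
by apply/negP => /int_arc_ends [/= h _]; move: h; apply/negP/tail_notin_int.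
Qed.

Lemma sharp_tail j k : val (sharp j k) \notin int_arcs G.
Proof.
by apply/negP => /int_arc_ends [/= _ h]; move: h; apply/negP/tail_notin_int.
Qed.

Definition tail_flat j k : tail_arc := Sub (flat j k) (flat_tail j k).
Definition tail_sharp j k : tail_arc := Sub (sharp j k) (sharp_tail j k).

Lemma flat_inj i j k l : flat i k = flat j l -> i = j /\ k = l.
Proof. by move=> /(congr1 val) [] /tail_inj. Qed.

Lemma sharp_inj i j k l : sharp i k = sharp j l -> i = j /\ k = l.
Proof. by move=> /(congr1 val) [] _ /tail_inj. Qed.

Lemma flat_neq_sharp i j k l : flat i k <> sharp j l.
Proof.
move=> /(congr1 val) [].
case: l => [|l] e1 e2.
  by have := tail_notin_int G i k; rewrite e1 tail0_int.
case: k e1 e2 => [|k] /tail_inj [_ e1] e2.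
  by have := tail_notin_int G j l.+1; rewrite -e2 tail0_int.
move: e2 => /tail_inj [_ e2].
have kl : (k < l)%N by rewrite -e1.
have lk : (l < k)%N by rewrite e2.
by have := ltn_trans kl lk; rewrite ltnn.
Qed.

Lemma tail_index_finite v : finite_set [set x : 'I_N * nat | tail G x.1 x.2 = v].
Proof.
have fin0 : finite_set [set x : 'I_N * nat | x.2 = 0%N].
  apply: (@sub_finite_set _ _ ((fun j => (j, 0%N)) @` [set: 'I_N])).
    by move=> [j k] /= ->; exists j.
  exact/finite_image/finite_finset.
have [[i [k e]]|no] :=
    pselect (exists i k, tail G i k.+1 = v); last first.
  apply: sub_finite_set fin0 => -[j [|k]] //= e.
  by exfalso; apply: no; exists j, k.
apply: (@sub_finite_set _ _
    ([set x : 'I_N * nat | x.2 = 0%N] `|` [set (i, k.+1)])).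
  move=> [j [|l]] /= e'; first by left.
  by right; move: e'; rewrite -e => /tail_inj [-> ->].
by rewrite finite_setU; split => //; apply: finite_set1.
Qed.

Lemma in_arcs_finite v : finite_set (in_arcs v).
Proof.
pose I := [set x : 'I_N * nat | tail G x.1 x.2 = v].
apply: (@sub_finite_set _ _ ([set arc_of_int a | a in [set: int_arc]] `|`
    ((fun x => flat x.1 x.2) @` I `|` (fun x => sharp x.1 x.2.-1) @` I))).
  move=> a av.
  have [ha|[j [k e]]|[j [k e]]] := (arc_cover (val a)).1 (valP a).
  - by left; exists (FSetSub ha) => //; apply: val_inj.
  - right; left; exists (j, k); last by apply: val_inj; rewrite /= e.
    by rewrite /I /= -av /target e.
  - right; right; exists (j, k.+1); last by apply: val_inj; rewrite /= e.
    by rewrite /I /= -av /target e.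
rewrite !finite_setU; split; first exact/finite_image/finite_finset.
by split; apply/finite_image/tail_index_finite.
Qed.

End Arcs.

Section Hilbert.
Context {R : realType}.

Definition cexp (z : R[i]) : R[i] :=
  (expR (complex.Re z))%:C%C * (cos (complex.Im z) +i* sin (complex.Im z))%C.

Definition l2norm2 (X : choiceType) (psi : X -> R[i]) : \bar R :=
  \esum_(x in [set: X])
    (complex.Re (psi x) ^+ 2 + complex.Im (psi x) ^+ 2)%:E.

Definition l2 (X : choiceType) : set (X -> R[i]) :=
  [set psi | (l2norm2 psi < +oo)%E].

(* Operators on l2 X are represented by maps on all of X -> R[i], of which only
   the values on l2 X are constrained.  Unitary means surjective linear
   isometry. *)
Definition unitary_on_l2 (X : choiceType) (T : (X -> R[i]) -> (X -> R[i])) :=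
  [/\ forall (x y : R[i]) psi phi, l2 psi -> l2 phi ->
        T (fun a => x * psi a + y * phi a) = fun a => x * T psi a + y * T phi a,
      forall psi, l2 psi -> l2norm2 (T psi) = l2norm2 psi
    & forall phi, l2 phi -> exists2 psi, l2 psi & T psi = phi].

Definition finite_rank_on_l2 (X : choiceType)
    (T : (X -> R[i]) -> (X -> R[i])) :=
  exists (n : nat) (f : 'I_n -> X -> R[i]), (forall i, l2 (f i)) /\
    forall psi, l2 psi ->
      exists x : 'I_n -> R[i], T psi = fun a => \sum_(i < n) x i * f i a.

Definition eigenvalue_on_l2 (X : choiceType)
    (T : (X -> R[i]) -> (X -> R[i])) (z : R[i]) :=
  exists psi, [/\ l2 psi, psi <> (fun=> 0) & T psi = fun a => z * psi a].

End Hilbert.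

Section QuantumWalk.
Context {R : realType} {N : nat} {G : graph_with_tails N}.

Local Notation state := (oarc G -> R[i]).
Local Notation operator := (state -> state).

(* c v a b is the entry c^v_{a,b}; only a and b in in_arcs v matter. *)
Definition unitary_coin (c : vertex G -> oarc G -> oarc G -> R[i]) :=
  forall v a b, in_arcs v a -> in_arcs v b ->
    \sum_(e \in in_arcs v) c v a e * (c v b e)^*%C = (a == b)%:R /\
    \sum_(e \in in_arcs v) (c v e a)^*%C * c v e b = (a == b)%:R.

Definition shift : operator := fun psi a => psi (rev_arc a).

(* By in_arcs_finite the finitely supported sum is the usual one. *)
Definition coin (c : vertex G -> oarc G -> oarc G -> R[i]) : operator :=
  fun psi a => \sum_(b \in in_arcs (target a)) c (target a) a b * psi b.

Definition walk (c : vertex G -> oarc G -> oarc G -> R[i]) : operator :=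
  shift \o coin c.

Definition chi_int (psi : state) : int_arc G -> R[i] :=
  fun a => psi (arc_of_int a).

Definition chi_int_adj (phi : int_arc G -> R[i]) : state :=
  fun a => if insub (val a) is Some b then phi b else 0.

Definition chi_tail (psi : state) : tail_arc G -> R[i] :=
  fun a => psi (val a).

Definition free_on_tails (U : operator) :=
  forall psi j k, l2 psi ->
    U psi (flat G j k) = psi (flat G j k.+1) /\
    U psi (sharp G j k.+1) = psi (sharp G j k).

Definition decoupled (U0 : operator) :=
  exists (Ut : (tail_arc G -> R[i]) -> (tail_arc G -> R[i]))
         (Uint : (int_arc G -> R[i]) -> (int_arc G -> R[i])),
  [/\ forall psi, l2 psi ->
        chi_tail (U0 psi) = Ut (chi_tail psi) /\
        chi_int (U0 psi) = Uint (chi_int psi),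
      forall phi j, l2 phi -> Ut phi (tail_sharp G j 0) = phi (tail_flat G j 0)
    & unitary_on_l2 Uint].

Definition finite_rank_perturbation (U U0 : operator) :=
  [/\ unitary_on_l2 U /\ unitary_on_l2 U0,
      free_on_tails U /\ free_on_tails U0,
      decoupled U0
    & finite_rank_on_l2 (fun psi a => U psi a - U0 psi a)].

Definition compression (U : operator) :
    (int_arc G -> R[i]) -> (int_arc G -> R[i]) :=
  chi_int \o U \o chi_int_adj.

(* Columns are the images of the basis vectors.  The library predicate eigenvalue
   acts on row vectors, which does not change the eigenvalues of a square
   matrix. *)
Definition compression_mx (U : operator) : 'M[R[i]]_#|int_arc G| :=
  \matrix_(i, j)
    compression U (fun b => (b == enum_val j)%:R) (enum_val i).

(* The default value 1 of xget is taken exactly on the arcs of int_arcs. *)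
Definition q (theta : R[i]) (a : oarc G) : R[i] :=
  xget 1 [set w |
    (exists j k, a = flat G j k /\ w = cexp ('i%C * theta * k%:R)) \/
    (exists j l, a = sharp G j l /\ w = cexp (- 'i%C * theta * l.+1%:R))].

Lemma q_flat theta j k : q theta (flat G j k) = cexp ('i%C * theta * k%:R).
Proof.
rewrite /q; apply: xget_unique; first by left; exists j, k.
by move=> w [[i [l [/flat_inj [_ ->]]]]|[i [l [/flat_neq_sharp]]]].
Qed.

Lemma q_sharp theta j l :
  q theta (sharp G j l) = cexp (- 'i%C * theta * l.+1%:R).
Proof.
rewrite /q; apply: xget_unique; first by right; exists j, l.
by move=> w [[i [k [/esym/flat_neq_sharp]]]|[i [k [/sharp_inj [_ ->]]]]].
Qed.

Lemma q_int theta a : q theta (arc_of_int a) = 1.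
Proof.
rewrite /q; case: xgetP => // w _ [[j [k [e _]]]|[j [k [e _]]]].
  by have := flat_tail G j k; rewrite -e /= fsvalP.
by have := sharp_tail G j k; rewrite -e /= fsvalP.
Qed.

Definition Q (theta : R[i]) : operator := fun psi a => q theta a * psi a.
Definition Qinv (theta : R[i]) : operator := fun psi a => (q theta a)^-1 * psi a.

(* U(theta), as an operator on all functions, for every complex theta; its
   restriction to l2 is the analytic continuation from real theta to
   Im theta < 0. *)
Definition distort (U : operator) (theta : R[i]) : operator :=
  Q theta \o U \o Qinv theta.

Definition resonance (U : operator) (z : R[i]) :=
  exists lambda theta : R[i],
    [/\ z = cexp (- 'i%C * lambda),
        complex.Im theta < 0, complex.Im theta < complex.Im lambda
      & eigenvalue_on_l2 (distort U theta) z].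

End QuantumWalk.

(* Main.v *)
(* If psi is an l2 eigenfunction of U(theta) for z = exp(-i lambda), then
   phi = Q(theta)^-1 psi satisfies U phi = z phi on all arcs.  Freeness makes phi
   geometric on each tail; after distortion the ratio along the incoming arcs
   has modulus exp(Im lambda - Im theta) > 1, so phi vanishes there and its
   restriction to the interior is an eigenvector of E.  If that restriction
   vanished, then so would phi on the first outgoing arcs, hence everywhere.
   Conversely, an eigenvector of E, extended by 0 on the incoming arcs, extends
   uniquely to a solution of U phi = z phi, which is geometric on the outgoing
   arcs and becomes l2 after distortion by theta = lambda - i. *)
Require Import Defs.
From mathcomp Require Import all_boot all_order all_algebra.
From mathcomp Require Import finmap complex.
From mathcomp Require Import all_classical all_reals all_analysis.
From mathcomp Require Import ring lra.

Import Order.TTheory GRing.Theory Num.Theory.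
Local Open Scope ring_scope.

(** * The complex exponential and squared moduli *)

Section ComplexExponential.
Context {R : realType}.
Implicit Types (z w : R[i]) (n : nat).

(** The squared modulus, kept real-valued and spelled exactly as the summand of [l2norm2], so that
    [l2norm2E] holds by conversion. *)
Definition sqnorm z : R := complex.Re z ^+ 2 + complex.Im z ^+ 2.

Lemma sqnorm_ge0 z : 0 <= sqnorm z.
Proof. by rewrite addr_ge0 // sqr_ge0. Qed.

Lemma sqnorm0 : sqnorm 0 = 0.
Proof. by rewrite /sqnorm /= expr0n addr0. Qed.

Lemma sqnorm_eq0 z : sqnorm z = 0 -> z = 0.
Proof.
case: z => x y /eqP; rewrite /sqnorm /= paddr_eq0 ?sqr_ge0 //.
by rewrite !sqrf_eq0 => /andP[/eqP-> /eqP->].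
Qed.

Lemma sqnormM z w : sqnorm (z * w) = sqnorm z * sqnorm w.
Proof. by case: z w => [x y] [x' y']; rewrite /sqnorm /=; ring. Qed.

Lemma cexpD z w : cexp (z + w) = cexp z * cexp w.
Proof.
case: z w => [x y] [x' y']; rewrite /cexp /= expRD cosD sinD.
by apply/eqP; rewrite eq_complex /=; apply/andP; split; apply/eqP; ring.
Qed.

Lemma cexp0 : cexp 0 = 1 :> R[i].
Proof.
rewrite /cexp /= expR0 cos0 sin0; apply/eqP.
by rewrite eq_complex /= !mul0r !mulr0 subr0 addr0 mulr1 !eqxx.
Qed.

Lemma cexp_neq0 z : cexp z != 0.
Proof.
apply/eqP => z0; have := cexpD z (- z); rewrite subrr cexp0 z0 mul0r.
by move/eqP; rewrite oner_eq0.
Qed.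

Lemma cexpV z : (cexp z)^-1 = cexp (- z).
Proof.
by apply: (mulfI (cexp_neq0 z)); rewrite divff ?cexp_neq0 // -cexpD subrr cexp0.
Qed.

Lemma cexpMn z n : cexp (z * n%:R) = cexp z ^+ n.
Proof.
elim: n => [|n IHn]; first by rewrite mulr0 cexp0 expr0.
by rewrite -natr1 mulrDr mulr1 cexpD IHn exprSr.
Qed.

Lemma sqnorm_cexp z : sqnorm (cexp z) = expR (complex.Re z) ^+ 2.
Proof. by rewrite /cexp sqnormM /sqnorm /= cos2Dsin2 mulr1; ring.
Qed.

Lemma Re_NiM z : complex.Re (- 'i%C * z) = complex.Im z.
Proof. by case: z => x y /=; ring. Qed.

Lemma sqnorm_cexpNi z : sqnorm (cexp (- 'i%C * z)) = expR (complex.Im z) ^+ 2.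
Proof. by rewrite sqnorm_cexp Re_NiM. Qed.

Lemma sqnormXn z n : sqnorm (z ^+ n) = sqnorm z ^+ n.
Proof.
elim: n => [|n IHn]; first by rewrite !expr0 /sqnorm /= expr1n expr0n addr0.
by rewrite !exprS sqnormM IHn.
Qed.

End ComplexExponential.

(** If [a] were positive, [(M + 1) * r^-1 ^+ k], which tends to 0, would fall below [a] for some
    [k], giving [M + 1 < r ^+ k * a <= M]. *)
Lemma unbounded_geometric (R : realType) (r a M : R) :
  1 < r -> 0 <= a -> (forall k, r ^+ k * a <= M) -> a = 0.
Proof.
move=> r1 a0 bnd; apply/eqP; case: (eqVneq a 0) => // an0; exfalso.
have ap : 0 < a by rewrite lt_neqAle eq_sym an0.
have r'1 : `|r^-1| < 1.
  by rewrite ger0_norm ?invr_ge0 ?invf_lt1 //; lra.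
have M0 : 0 < M + 1 by have := bnd 0; rewrite expr0; lra.
have := cvg_geometric (M + 1) r'1.
move/cvgrPdist_lt => /(_ a ap) [k _ /(_ k (leqnn k))] /=.
rewrite sub0r normrN ger0_norm; last first.
  by rewrite mulr_ge0 ?exprn_ge0 ?invr_ge0; lra.
rewrite exprVn ltr_pdivrMr ?exprn_gt0; try lra.
by have := bnd k; lra.
Qed.

Lemma nneseries_geometric_lty (R : realType) (r K : R) :
  0 < r < 1 -> 0 <= K -> (\sum_(0 <= i <oo) (K * r ^+ i)%:E < +oo)%E.
Proof.
move=> /andP[r0 r1] K0.
apply: (@le_lt_trans _ _ (K / (1 - r))%:E); last by rewrite ltry.
apply: lime_le.
  by apply: is_cvg_nneseries => i _ _; rewrite lee_fin mulr_ge0 ?exprn_ge0 // ltW.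
apply: nearW => n; rewrite sumEFin lee_fin.
by apply: geometric_le_lim => //; rewrite ger0_norm // ltW.
Qed.

(** * Criteria for square summability *)

Section SquareSummable.
Context {R : realType} {X : choiceType}.
Implicit Types psi : X -> R[i].

Lemma l2norm2E psi :
  l2norm2 psi = (\esum_(x in [set: X]) (sqnorm (psi x))%:E)%E.
Proof. by []. Qed.

Lemma l2_finite_support psi (A : set X) :
  finite_set A -> (forall x, ~ A x -> psi x = 0) -> l2 psi.
Proof.
move=> finA psi0; rewrite /l2 /= l2norm2E.
rewrite (_ : esum _ _ = (\esum_(x in A) (sqnorm (psi x))%:E)%E); last first.
  rewrite [RHS]esum_mkcond; apply: eq_esum => x _.
  by case: (boolP (x \in A)); rewrite ?notin_setE // => /psi0 ->; rewrite sqnorm0.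
rewrite esum_fset //; last by move=> x _; rewrite lee_fin sqnorm_ge0.
by rewrite fsbig_finite //= sumEFin ltry.
Qed.

Lemma l2_bounded psi : l2 psi -> exists M, forall x, sqnorm (psi x) <= M.
Proof.
rewrite /l2 /= l2norm2E => psi_lty.
have psi_ge0 : (0 <= \esum_(x in [set: X]) (sqnorm (psi x))%:E)%E.
  by apply: esum_ge0 => x _; rewrite lee_fin sqnorm_ge0.
exists (fine (\esum_(x in [set: X]) (sqnorm (psi x))%:E)%E) => x.
rewrite -lee_fin fineK; last by rewrite ge0_fin_numE.
apply: esum_ge; exists [set x]%classic; last by rewrite fsbig_set1.
by split => //; exact: finite_set1.
Qed.

(** The sum is majorised by a finite sum over [A] plus one convergent geometric series for each [j].
    Overlaps among [A] and the ranges of the [f j] only enlarge this majorant. *)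
Lemma l2_geometric psi (n : nat) (A : set X) (f : 'I_n -> nat -> X) (r : R)
    (K : 'I_n -> R) :
  finite_set A -> (forall j, injective (f j)) -> 0 < r < 1 ->
  (forall x, [\/ A x, exists j k, x = f j k | psi x = 0]) ->
  (forall j k, sqnorm (psi (f j k)) <= K j * r ^+ k) -> l2 psi.
Proof.
move=> finA f_inj r01 cover bnd; rewrite /l2 /= l2norm2E.
pose g x := (sqnorm (psi x))%:E.
have g0 x : (0 <= g x)%E by rewrite lee_fin sqnorm_ge0.
have g1 (B : set X) x : (0 <= if x \in B then g x else 0)%E by case: ifP.
apply: (@le_lt_trans _ _ (\esum_(x in [set: X])
    ((if x \in A then g x else 0) +
     \sum_(j <- index_enum 'I_n | true) if x \in range (f j) then g x else 0))%E).
  apply: le_esum => x _; rewrite -/(g x).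
  have [Ax|[j [k xE]]|psi0] := cover x.
  - by rewrite (mem_set Ax) leeDl // sume_ge0.
  - rewrite (bigD1 j) //=.
    rewrite (_ : x \in range (f j)); last by apply/mem_set; exists k.
    by rewrite addeCA leeDl // adde_ge0 // sume_ge0.
  - by rewrite {1}/g psi0 sqnorm0 adde_ge0 // sume_ge0.
rewrite esumD => [|//|x _]; last by rewrite sume_ge0.
rewrite lte_add_pinfty //.
  rewrite -esum_mkcond esum_fset // fsbig_finite //= sumEFin.
  exact: ltry.
rewrite esum_sum // lte_sum_pinfty // => j _.
rewrite -esum_mkcond esum_image; last by move=> ? ? _ _ /f_inj.
rewrite -nneseries_esumT //.
have K0 : 0 <= K j.
  by have := bnd j 0; rewrite expr0 mulr1; apply: le_trans; exact: sqnorm_ge0.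
apply: le_lt_trans (nneseries_geometric_lty _ _ _ r01 K0).
by apply: lee_nneseries => // k _; rewrite lee_fin.
Qed.

End SquareSummable.

(** Being an eigenvalue means that [A - a%:M] is not invertible, and transposition preserves
    invertibility. *)
Lemma eigenvalue_trmx (F : fieldType) (n : nat) (A : 'M[F]_n) (a : F) :
  eigenvalue A^T a = eigenvalue A a.
Proof.
rewrite /eigenvalue /eigenspace !kermx_eq0 !row_free_unit.
by rewrite -[a%:M in LHS]tr_scalar_mx -linearB unitmx_tr.
Qed.

(** * Arcs, states with prescribed values, and the distortion *)

Section ArcsOfGraphWithTails.
Context {N : nat} {G : graph_with_tails N}.

Lemma arc_cases (a : oarc G) :
  [\/ exists b, a = arc_of_int b, exists j k, a = flat G j k
    | exists j k, a = sharp G j k].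
Proof.
have [ha|[j [k e]]|[j [k e]]] := (arc_cover (val a)).1 (valP a).
- by constructor 1; exists (FSetSub ha); apply: val_inj.
- by constructor 2; exists j, k; apply: val_inj.
- by constructor 3; exists j, k; apply: val_inj.
Qed.

Lemma arc_of_int_inj : injective (@arc_of_int N G).
Proof. by move=> a b /(congr1 val) /= /val_inj. Qed.

Lemma arc_of_int_neq_flat (b : int_arc G) j k : arc_of_int b <> flat G j k.
Proof. by move=> e; have := flat_tail G j k; rewrite -e /= fsvalP. Qed.

Lemma arc_of_int_neq_sharp (b : int_arc G) j k : arc_of_int b <> sharp G j k.
Proof. by move=> e; have := sharp_tail G j k; rewrite -e /= fsvalP. Qed.

Lemma source_arc_of_int (b : int_arc G) : source (arc_of_int b) \in int_vertices G.
Proof. by have [] := int_arc_ends (fsvalP b). Qed.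

(** Every other tail arc ends at a tail vertex of positive index, which lies outside the
    interior. *)
Lemma in_arcs_int {v : vertex G} {b : oarc G} :
  v \in int_vertices G -> in_arcs v b ->
  (exists e, b = arc_of_int e) \/ exists j, b = flat G j 0.
Proof.
rewrite /in_arcs /= => + bv; rewrite -{}bv.
have [[e ->]|[j [[|k] ->]]|[j [k ->]]] := arc_cases b.
- by left; exists e.
- by right; exists j.
- by rewrite (negbTE (tail_notin_int G j k)).
- by rewrite (negbTE (tail_notin_int G j k)).
Qed.

(** The three families of arcs are injectively indexed and pairwise disjoint, so prescribed values
    never conflict. This builds the eigenfunction in the converse direction. *)
Lemma state_exists (T : Type) (t0 : T) (f : int_arc G -> T)
    (g h : 'I_N -> nat -> T) :
  exists phi : oarc G -> T,
    [/\ forall b, phi (arc_of_int b) = f b,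
        forall j k, phi (flat G j k) = g j k
      & forall j k, phi (sharp G j k) = h j k].
Proof.
have /choice [phi phiP] (a : oarc G) : exists w : T,
    [/\ forall b, a = arc_of_int b -> w = f b,
        forall j k, a = flat G j k -> w = g j k
      & forall j k, a = sharp G j k -> w = h j k].
  have [[e ->]|[i [l ->]]|[i [l ->]]] := arc_cases a.
  - exists (f e); split=> [b /arc_of_int_inj -> //|j k|j k].
      by move/arc_of_int_neq_flat.
    by move/arc_of_int_neq_sharp.
  - exists (g i l); split=> [b /esym /arc_of_int_neq_flat //|j k|j k].
      by move=> /flat_inj [-> ->].
    by move/flat_neq_sharp.
  - exists (h i l); split=> [b /esym /arc_of_int_neq_sharp //|j k|j k].
      by move=> /esym /flat_neq_sharp.
    by move=> /sharp_inj [-> ->].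
exists phi; split=> [b|j k|j k].
- by have [+ _ _] := phiP (arc_of_int b); exact.
- by have [_ + _] := phiP (flat G j k); exact.
- by have [_ _ +] := phiP (sharp G j k); exact.
Qed.

Context {R : realType}.
Implicit Types (psi phi : oarc G -> R[i]) (v : int_arc G -> R[i]).

Lemma chi_int_adj_int v b : chi_int_adj v (arc_of_int b) = v b.
Proof. by rewrite /chi_int_adj /= valK. Qed.

Lemma chi_int_adj_flat v j k : chi_int_adj v (flat G j k) = 0.
Proof. by rewrite /chi_int_adj insubN // flat_tail. Qed.

Lemma chi_int_adj_sum v a :
  chi_int_adj v a = \sum_b v b * chi_int_adj (fun e => (e == b)%:R) a.
Proof.
rewrite /chi_int_adj; case: insubP => [e _ _|_]; last first.
  by rewrite big1 // => b _; rewrite mulr0.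
rewrite (bigD1 e) //= eqxx mulr1 big1 ?addr0 // => b.
by rewrite eq_sym => /negbTE ->; rewrite mulr0.
Qed.

Lemma q_neq0 (theta : R[i]) (a : oarc G) : q theta a != 0.
Proof.
have [[e ->]|[i [l ->]]|[i [l ->]]] := arc_cases a.
- by rewrite q_int oner_neq0.
- by rewrite q_flat cexp_neq0.
- by rewrite q_sharp cexp_neq0.
Qed.

(** [Q theta] multiplies by the nowhere vanishing [q theta], so the conjugation cancels pointwise.
    It is stated for all functions because [phi] may grow along the tails. *)
Lemma distort_eigenvectorP (U : (oarc G -> R[i]) -> oarc G -> R[i])
    (theta z : R[i]) phi :
  distort U theta (Q theta phi) = (fun a => z * Q theta phi a) <->
  forall a, U phi a = z * phi a.
Proof.
have -> : distort U theta (Q theta phi) = Q theta (U phi).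
  rewrite /distort /= (_ : Qinv theta (Q theta phi) = phi) //.
  by apply/funext => a; rewrite /Qinv /Q mulrA mulVf ?q_neq0 // mul1r.
split=> [UE a|UE]; last by apply/funext => a; rewrite /Q UE mulrCA.
by move: (congr1 (@^~ a) UE); rewrite /Q mulrCA; apply: mulfI; exact: q_neq0.
Qed.

(** * Locality of the walk, its compression, and eigenfunctions on the tails *)

Section Walk.
Variable c : vertex G -> oarc G -> oarc G -> R[i].

Lemma walkE psi a :
  walk c psi a = \sum_(b <- fset_set (in_arcs (source a)))
    c (source a) (rev_arc a) b * psi b.
Proof.
by rewrite /walk /Defs.shift /coin /= fsbig_finite //; exact: in_arcs_finite.
Qed.

(** The value at [a] only involves the arcs entering [source a]. This allows a state to be truncated
    or replaced by its interior part. *)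
Lemma walk_local psi phi a :
  (forall b, in_arcs (source a) b -> psi b = phi b) ->
  walk c psi a = walk c phi a.
Proof.
move=> eq_psi; rewrite !walkE; apply: eq_big_seq => b.
by rewrite in_fset_set ?inE; [move/eq_psi ->|exact: in_arcs_finite].
Qed.

(** The only tail arcs entering an interior vertex are arcs [flat j 0], so once [psi] vanishes there
    the walk sees just the interior values. *)
Lemma walk_chi_int psi a :
  source a \in int_vertices G -> (forall j, psi (flat G j 0) = 0) ->
  walk c psi a = walk c (chi_int_adj (chi_int psi)) a.
Proof.
move=> av psi0; apply: walk_local => b /(in_arcs_int av) [[e ->]|[j ->]].
  by rewrite chi_int_adj_int.
by rewrite chi_int_adj_flat psi0.
Qed.

(* The hypothesis constrains [walk c] on [l2] only, while the relevant
   eigenfunctions of [walk c] grow along the tails. *)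
Lemma free_on_tailsT : free_on_tails (walk c) -> forall psi j k,
  walk c psi (flat G j k) = psi (flat G j k.+1) /\
  walk c psi (sharp G j k.+1) = psi (sharp G j k).
Proof.
move=> free psi j k.
(* Finitely many arcs enter [u], so [cut u] lies in [l2], while by locality the walk on arcs leaving
   [u] does not notice the truncation. *)
pose cut (u : vertex G) (b : oarc G) := if b \in in_arcs u then psi b else 0.
have cut_l2 u : l2 (cut u).
  apply: (l2_finite_support _ _ (in_arcs_finite u)) => b nb.
  by rewrite /cut memNset.
have cutE u b : in_arcs u b -> psi b = cut u b by rewrite /cut => /mem_set ->.
split; rewrite (walk_local _ _ _ (cutE _)).
- by have [-> _] := free _ j k (cut_l2 (source (flat G j k))); rewrite -cutE.
- by have [_ ->] := free _ j k (cut_l2 (source (sharp G j k.+1))); rewrite -cutE.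
Qed.

Lemma compression_walk_sum v a :
  compression (walk c) v a =
  \sum_b v b * compression (walk c) (fun e => (e == b)%:R) a.
Proof.
rewrite /compression /chi_int /= walkE.
under [LHS]eq_bigr => e _ do rewrite chi_int_adj_sum mulr_sumr.
rewrite exchange_big /=; apply: eq_bigr => b _.
by rewrite walkE mulr_sumr; apply: eq_bigr => e _; rewrite mulrCA.
Qed.

(** Transposing turns the row vectors of [eigenvalue] into the columns on which the compression
    acts; [enum_val] and [enum_rank] translate between arcs and matrix indices. *)
Lemma eigenvalue_compressionP (z : R[i]) :
  eigenvalue (compression_mx (walk c)) z <->
  exists2 v, v <> (fun=> 0) & forall a, compression (walk c) v a = z * v a.
Proof.
rewrite -eigenvalue_trmx; split=> [/eigenvalueP [u uE u0]|[v v0 vE]].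
  exists (fun b => u 0 (enum_rank b)) => [/(congr1 (@^~ _)) u'|a].
    move/eqP: u0; apply; apply/rowP => i.
    by rewrite mxE -(enum_valK i) u'.
  move/rowP: uE => /(_ (enum_rank a)); rewrite !mxE => <-.
  rewrite compression_walk_sum (reindex_onto enum_val enum_rank) /=; last first.
    by move=> b _; rewrite enum_rankK.
  apply: eq_big => [i|i _]; first by rewrite enum_valK eqxx.
  by rewrite enum_valK !mxE enum_rankK.
apply/eigenvalueP; exists (\row_i v (enum_val i)); last first.
  apply/eqP => /rowP u0; apply: v0; apply/funext => b.
  by have := u0 (enum_rank b); rewrite !mxE enum_rankK.
apply/rowP => i; rewrite !mxE -vE compression_walk_sum.
rewrite [RHS](reindex_onto enum_val enum_rank) /=; last first.
  by move=> b _; rewrite enum_rankK.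
apply: eq_big => [k|k _]; first by rewrite enum_valK eqxx.
by rewrite !mxE.
Qed.

Hypothesis free : free_on_tails (walk c).

(** On an incoming arc the walk reads the next arc outward, so each step outward multiplies by
    [z]. *)
Lemma eigenfunction_flat z phi : (forall a, walk c phi a = z * phi a) ->
  forall j k, phi (flat G j k) = z ^+ k * phi (flat G j 0).
Proof.
move=> phiE j; elim=> [|k IHk]; first by rewrite mul1r.
by have [<- _] := free_on_tailsT free phi j k; rewrite phiE IHk mulrA exprS.
Qed.

(** On an outgoing arc the walk reads the previous arc, so each step outward divides by [z]. *)
Lemma eigenfunction_sharp z phi : z != 0 -> (forall a, walk c phi a = z * phi a) ->
  forall j k, phi (sharp G j k) = z ^- k * phi (sharp G j 0).
Proof.
move=> z0 phiE j; elim=> [|k IHk]; first by rewrite expr0 invr1 mul1r.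
apply: (mulfI z0); rewrite -phiE; have [_ ->] := free_on_tailsT free phi j k.
by rewrite IHk exprS invfM !mulrA divff // mul1r.
Qed.

End Walk.
End ArcsOfGraphWithTails.

(** * The two directions of the equivalence *)

Section ResonancesAndCompression.
Context {N : nat} {G : graph_with_tails N} {R : realType}.
Variable c : vertex G -> oarc G -> oarc G -> R[i].
Hypothesis free : free_on_tails (walk c).

Lemma l2_eigenfunction_flat (lambda theta : R[i]) (phi : oarc G -> R[i]) :
  complex.Im theta < complex.Im lambda -> l2 (Q theta phi) ->
  (forall a, walk c phi a = cexp (- 'i%C * lambda) * phi a) ->
  forall j, phi (flat G j 0) = 0.
Proof.
move=> lt_th_la /l2_bounded [M bnd] phiE j; apply: sqnorm_eq0.
(* The factor by which the squared modulus of [Q theta phi] is multiplied from one incoming arc to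
   the next. *)
pose r := expR (complex.Im (lambda - theta)) ^+ 2.
apply: (unbounded_geometric R r _ M); last first.
- move=> k; apply: le_trans (bnd (flat G j k)).
  rewrite /Q q_flat (eigenfunction_flat c free _ _ phiE _ k) mulrA -!cexpMn -cexpD.
  rewrite (_ : _ + _ = - 'i%C * (lambda - theta) * k%:R); last by ring.
  by rewrite cexpMn sqnormM sqnormXn sqnorm_cexpNi.
- exact: sqnorm_ge0.
- by rewrite /r exprn_egt1 // expR_gt1 raddfB subr_gt0.
Qed.

Lemma resonance_eigenvalue_compression (z : R[i]) :
  resonance (walk c) z -> eigenvalue (compression_mx (walk c)) z.
Proof.
move=> [lambda [theta [zE _ lt_th_la [psi [psi_l2 psi0 psiE]]]]].
have z0 : z != 0 by rewrite zE cexp_neq0.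
pose phi := Qinv theta psi.
have QphiE : Q theta phi = psi.
  by apply/funext => a; rewrite /Q /phi /Qinv mulrA divff ?q_neq0 // mul1r.
rewrite -QphiE in psi_l2 psi0 psiE.
have phiE := (distort_eigenvectorP _ _ _ _).1 psiE.
have flat0 : forall j, phi (flat G j 0) = 0.
  apply: (l2_eigenfunction_flat lambda theta) => // a.
  by rewrite phiE zE.
apply/eigenvalue_compressionP; exists (chi_int phi) => [v0|a]; last first.
  rewrite /compression /= {1}/chi_int -walk_chi_int ?phiE //.
  exact: source_arc_of_int.
apply: psi0; apply/funext => a; rewrite /Q (_ : phi a = 0) ?mulr0 //.
have [[e ->]|[i [l ->]]|[i [l ->]]] := arc_cases a.
- exact: (congr1 (@^~ e) v0).
- by rewrite (eigenfunction_flat c free _ _ phiE) flat0 mulr0.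
- rewrite (eigenfunction_sharp c free z _ z0 phiE) (_ : phi _ = 0) ?mulr0 //.
  (* The arc [sharp i 0] starts at an interior vertex, so the eigenvalue equation there expresses
     [z * phi] through the interior values, all zero by [v0]. *)
  apply: (mulfI z0); rewrite mulr0 -phiE walk_chi_int //; last exact: tail0_int.
  rewrite v0 walkE big1 // => b _.
  by rewrite /chi_int_adj; case: insubP => *; rewrite mulr0.
Qed.

Lemma eigenvalue_compression_resonance (lambda : R[i]) :
  complex.Im lambda < 0 ->
  eigenvalue (compression_mx (walk c)) (cexp (- 'i%C * lambda)) ->
  resonance (walk c) (cexp (- 'i%C * lambda)).
Proof.
set z := cexp _ => la0 /eigenvalue_compressionP [v v0 vE].
have z0 : z != 0 by rewrite cexp_neq0.
(* [w j] is the amplitude sent from the interior onto the first arc of tail [j]. The equation there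
   forces the value [z^-1 * w j], hence the exponent [k.+1] below. *)
pose w j := walk c (chi_int_adj v) (sharp G j 0).
have [phi [phi_int phi_flat phi_sharp]] := state_exists _ 0 v (fun _ _ => 0)
  (fun j k => z ^- k.+1 * w j).
have chi_phi : chi_int phi = v by apply/funext.
have phiE a : walk c phi a = z * phi a.
  have [[e ->]|[i [l ->]]|[i [[|l] ->]]] := arc_cases a.
  - by rewrite walk_chi_int ?source_arc_of_int // chi_phi phi_int -vE.
  - by have [-> _] := free_on_tailsT c free phi i l; rewrite !phi_flat mulr0.
  - rewrite walk_chi_int ?chi_phi //; last exact: tail0_int.
    by rewrite phi_sharp expr1 mulrA divff // mul1r.
  - have [_ ->] := free_on_tailsT c free phi i l.
    by rewrite !phi_sharp [in RHS]exprS invfM !mulrA divff // mul1r.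
(* With this shift, consecutive outgoing values of [Q theta phi] have ratio
   [cexp (- 'i%C * theta) * z^-1], which is [cexp (-1)]; its squared modulus is [r] below. *)
pose theta := lambda - 'i%C.
have ImE : complex.Im theta = complex.Im lambda - 1 by rewrite raddfB.
exists lambda, theta; split=> //; try by rewrite ImE; lra.
exists (Q theta phi); split; last exact/distort_eigenvectorP; last first.
  move=> psi0; apply: v0; apply/funext => e.
  have := congr1 (@^~ (arc_of_int e)) psi0.
  by rewrite /Q q_int mul1r phi_int.
pose r : R := expR (- 1) ^+ 2.
(* The factor [cexp (- 'i%C * theta)] in the constant comes from the numbering: [q] at [sharp j k]
   has exponent [k.+1]. *)
apply: (l2_geometric _ _ [set arc_of_int a | a in [set: int_arc G]]
  (sharp G) r (fun j => sqnorm (cexp (- 'i%C * theta) * phi (sharp G j 0)))).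
- exact/finite_image/finite_finset.
- by move=> j k l /sharp_inj [].
- by rewrite /r exprn_gt0 ?expR_gt0 //= exprn_ilt1 ?expR_ge0 // expR_lt1; lra.
- move=> a; have [[e ->]|[i [l ->]]|[i [l ->]]] := arc_cases a.
  + by constructor 1; exists e.
  + by constructor 3; rewrite /Q phi_flat mulr0.
  + by constructor 2; exists i, l.
- move=> j k.
  rewrite /Q q_sharp (eigenfunction_sharp c free z _ z0 phiE _ k).
  rewrite cexpMn -exprVn cexpV exprS [_ ^+ k * phi _]mulrC mulrACA.
  rewrite -exprMn -cexpD.
  rewrite (_ : _ + _ = - 'i%C * (- 'i%C)); last by rewrite /theta; ring.
  by rewrite !sqnormM sqnormXn sqnorm_cexpNi.
Qed.

End ResonancesAndCompression.

Theorem proposition3p6 (R : realType) (N : nat) (G : graph_with_tails N)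
    (c : vertex G -> oarc G -> oarc G -> R[i])
    (U0 : (oarc G -> R[i]) -> (oarc G -> R[i])) :
  unitary_coin c ->
  free_on_tails (walk c) ->
  finite_rank_perturbation (walk c) U0 ->
  forall lambda : R[i], complex.Im lambda < 0 ->
    resonance (walk c) (cexp (- 'i%C * lambda)) <->
    eigenvalue (compression_mx (walk c)) (cexp (- 'i%C * lambda)).
Proof.
move=> _ free _ lambda la0; split; first exact: resonance_eigenvalue_compression.
exact: eigenvalue_compression_resonance.
Qed.
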